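(* There is an absolute constant $c>0$ such that for all integers $k\ge 2$ and all integers $n\ge 3k$, $$r_k(n)\ge t_{k-1}(cn^2).$$
   Context: $r_k(n)$ denotes the minimum $N$ such that every coloring of the $k$-element subsets of an $N$-element set with $2$ colors contains a monochromatic subset of size $n$, i.e. a subset of size $n$ all of whose $k$-element subsets have the same color. The tower function $t_k(x)$ is defined by $t_1(x)=x$ and $t_{i+1}(x)=2^{t_i(x)}$. The constant $c$ does not depend on $k$ or $n$. *)

(* Defs.v *)
From mathcomp Require Import all_boot all_order all_algebra.
From mathcomp Require Import reals exp.

Set Implicit Arguments.
Unset Strict Implicit.
Unset Printing Implicit Defensive.

(* A 2-colouring of the k-subsets is given by a function on all subsets; only
   its values on the k-subsets are ever inspected. *)
Definition monochromatic (T : finType) (k : nat) (f : {set T} -> bool)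
    (A : {set T}) : bool :=
  [exists c : bool, [forall B : {set T},
     (B \subset A) && (#|B| == k) ==> (f B == c)]].

Definition ramsey_prop (k n N : nat) : bool :=
  [forall f : {ffun {set 'I_N} -> bool},
     [exists A : {set 'I_N}, (#|A| == n) && monochromatic k f A]].

(* Ramsey's theorem, needed for the minimum defining r_k(n) to exist. *)
Lemma finite_ramsey (k s t : nat) : exists N, forall (T : finType)
    (X : {set T}) (f : {set T} -> bool), N <= #|X| ->
  (exists A : {set T}, [/\ A \subset X, #|A| = s &
     forall B : {set T}, B \subset A -> #|B| = k -> f B = true]) \/
  (exists A : {set T}, [/\ A \subset X, #|A| = t &
     forall B : {set T}, B \subset A -> #|B| = k -> f B = false]).
Proof.
have sub (T : finType) (X : {set T}) m : m <= #|X| ->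
    exists2 A : {set T}, A \subset X & #|A| = m.
  move=> /card_geqP[u [uu <- uX]].
  exists [set x in u]; last by rewrite cardsE; apply/card_uniqP.
  by apply/subsetP => x; rewrite inE => /uX.
elim: k s t => [|k IHk] s t.
  exists (maxn s t) => T X f; rewrite geq_max => /andP[sX tX].
  case Ef: (f set0); [left | right].
    have [A AX cA] := sub _ _ _ sX; exists A; split=> // B _ /eqP.
    by rewrite cards_eq0 => /eqP->.
  have [A AX cA] := sub _ _ _ tX; exists A; split=> // B _ /eqP.
  by rewrite cards_eq0 => /eqP->.
have step (T : finType) (f : {set T} -> bool) x c (A A' : {set T}) :
    x \notin A -> A' \subset A ->
    (forall B : {set T}, B \subset A -> #|B| = k -> f (x |: B) = c) ->
    (forall B : {set T}, B \subset A' -> #|B| = k.+1 -> f B = c) ->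
    forall B : {set T}, B \subset x |: A' -> #|B| = k.+1 -> f B = c.
  move=> xA AA H H' B BA cB; have [xB | xB] := boolP (x \in B).
    rewrite -(setD1K xB); apply: H.
      by apply: subset_trans AA; rewrite subDset.
    by move: cB; rewrite (cardsD1 x) xB add1n => -[].
  apply: H' => //; apply/subsetP => y yB.
  have := subsetP BA y yB; rewrite !inE => /orP[/eqP yx | //].
  by rewrite -yx yB in xB.
elim: s t => [|s IHs] t.
  exists 0 => T X f _; left; exists set0.
  rewrite sub0set cards0; split=> // B.
  by rewrite subset0 => /eqP->; rewrite cards0.
elim: t => [|t [N2 IHt]].
  exists 0 => T X f _; right; exists set0.
  rewrite sub0set cards0; split=> // B.
  by rewrite subset0 => /eqP->; rewrite cards0.
have [N1 HN1] := IHs t.+1; have [N HN] := IHk N1 N2.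
exists N.+1 => T X f NX.
have [x xX] : exists x, x \in X by apply/card_gt0P; apply: leq_trans NX.
have NY : N <= #|X :\ x| by rewrite (cardsD1 x X) xX add1n in NX.
have [] := HN T (X :\ x) (fun B => f (x |: B)) NY.
  move=> [A [AX cA HA]].
  have xA : x \notin A.
    by apply/negP => /(subsetP AX); rewrite !inE eqxx.
  have AX' : A \subset X by apply: subset_trans AX (subD1set _ _).
  have [||] := HN1 T A f; first by rewrite cA.
    move=> [A' [AA cA' HA']]; left; exists (x |: A'); split.
    - by rewrite subUset sub1set xX (subset_trans AA).
    - by rewrite cardsU1 cA' (contra (subsetP AA x)).
    - exact: (step T f x true A A').
  move=> [A' [AA cA' HA']]; right; exists A'; split=> //.
  exact: subset_trans AX'.
move=> [A [AX cA HA]].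
have xA : x \notin A.
  by apply/negP => /(subsetP AX); rewrite !inE eqxx.
have AX' : A \subset X by apply: subset_trans AX (subD1set _ _).
have [||] := IHt T A f; first by rewrite cA.
  move=> [A' [AA cA' HA']]; left; exists A'; split=> //.
  exact: subset_trans AX'.
move=> [A' [AA cA' HA']]; right; exists (x |: A'); split.
- by rewrite subUset sub1set xX (subset_trans AA).
- by rewrite cardsU1 cA' (contra (subsetP AA x)).
- exact: (step T f x false A A').
Qed.

Lemma ramsey_exists (k n : nat) : exists N, ramsey_prop k n N.
Proof.
have [N HN] := finite_ramsey k n n; exists N.
apply/forallP => f; apply/existsP.
have [||] := HN 'I_N setT f; first by rewrite cardsT card_ord.
  move=> [A [_ cA HA]]; exists A; rewrite cA eqxx; apply/existsP; exists true.
  by apply/forallP => B; apply/implyP => /andP[BA /eqP cB]; apply/eqP/HA.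
move=> [A [_ cA HA]]; exists A; rewrite cA eqxx; apply/existsP; exists false.
by apply/forallP => B; apply/implyP => /andP[BA /eqP cB]; apply/eqP/HA.
Qed.

Definition ramsey_number (k n : nat) : nat := ex_minn (ramsey_exists k n).

(* Indexed from 1: tower 1 x = x and tower i.+1 x = 2 `^ tower i x for
   i >= 1; the value at i = 0 is a dummy. *)
Definition tower (R : realType) (i : nat) (x : R) : R :=
  iter i.-1 (fun y : R => (2 `^ y)%R) x.

(* Main.v *)
Require Import Defs.
From mathcomp Require Import all_boot all_order all_algebra.
From mathcomp Require Import reals exp.
From mathcomp Require Import zify.

Set Implicit Arguments.
Unset Strict Implicit.
Unset Printing Implicit Defensive.

Import Order.TTheory GRing.Theory Num.Theory.

(** The stepping-up construction in the form of Conlon, Fox and Sudakov.  Given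
    a colouring phi of the k-subsets of N without a monochromatic n-set, colour
    a (k+1)-subset of 2^N through the k successive values delta at which
    neighbouring elements differ in binary: by phi when this sequence is
    monotone, and otherwise by the parity of the position of its first local
    extremum plus the type (maximum or minimum) of that extremum.  Sliding a
    window of length k along the sequence of a monochromatic set changes this
    colour unless all extrema are next to the ends, so the sequence has a
    monotone run missing at most two terms (one term when k is odd), and phi is
    constant on a run.  Hence n grows by 3 for even k >= 4, by 2 for odd
    k >= 5, and doubles for k = 3.  From 4 to k the total loss is about 5k/2,
    which n >= 3k absorbs: at uniformity 3 a size proportional to n is left,
    and there a counting argument gives 2^(c n^2). *)

(** * Monotonicity of the Ramsey property *)

Lemma exists_subset_card (T : finType) (X : {set T}) m :
  m <= #|X| -> exists2 A : {set T}, A \subset X & #|A| = m.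
Proof.
move=> /card_geqP[u [uu <- uX]].
exists [set x in u]; last by rewrite cardsE; apply/card_uniqP.
by apply/subsetP => x; rewrite inE => /uX.
Qed.

Lemma monochromaticP (T : finType) k (f : {set T} -> bool) (A : {set T}) :
  reflect (exists c, forall B : {set T}, B \subset A -> #|B| = k -> f B = c)
          (monochromatic k f A).
Proof.
apply: (iffP existsP) => -[c H]; exists c.
  by move=> B BA cB; move/forallP/(_ B): H; rewrite BA cB eqxx => /eqP.
by apply/forallP => B; apply/implyP => /andP[BA /eqP cB]; apply/eqP/H.
Qed.

Lemma ramsey_prop_leq_size k m n N :
  m <= n -> ramsey_prop k n N -> ramsey_prop k m N.
Proof.
move=> mn /forallP H; apply/forallP => f.
have /existsP[A /andP[/eqP cA /monochromaticP[c Hc]]] := H f.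
have [|A' A'A cA'] := @exists_subset_card _ A m; first by rewrite cA.
apply/existsP; exists A'; rewrite cA' eqxx; apply/monochromaticP; exists c.
by move=> B BA'; apply: Hc; apply: subset_trans A'A.
Qed.

Lemma ramsey_prop_leq_order k n N M :
  N <= M -> ramsey_prop k n N -> ramsey_prop k n M.
Proof.
move=> NM /forallP H; apply/forallP => f.
pose h := widen_ord NM.
have h_inj : injective h by move=> x y /(congr1 val) /= /val_inj.
have /existsP[A] := H [ffun B : {set 'I_N} => f (h @: B)].
move=> /andP[/eqP cA /monochromaticP[c Hc]].
apply/existsP; exists (h @: A); rewrite card_imset // cA eqxx.
apply/monochromaticP; exists c => B BA cB.
have eB : h @: (h @^-1: B) = B.
  apply/setP => y; apply/imsetP/idP => [[x] | yB].
    by rewrite inE => xB ->.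
  have /imsetP[x xA yx] := subsetP BA y yB.
  by exists x; rewrite // inE -yx.
have := Hc (h @^-1: B); rewrite ffunE eB; apply.
  apply/subsetP => x; rewrite inE => /(subsetP BA) /imsetP[z zA /h_inj ->].
  by [].
by rewrite -cB -{2}eB card_imset.
Qed.

Lemma ramsey_number_gt k n N : ~~ ramsey_prop k n N -> N < ramsey_number k n.
Proof.
rewrite /ramsey_number; case: ex_minnP => r Hr _.
by rewrite ltnNge; apply: contra => rN; apply: ramsey_prop_leq_order Hr.
Qed.

(** * The counting lower bound *)

Lemma card_constant_ffun (T : finType) (S : {set T}) (c : bool) :
  #|[set f : {ffun T -> bool} | [forall x in S, f x == c]]| = 2 ^ (#|T| - #|S|).
Proof.
pose F x := [pred b : bool | (x \in S) ==> (b == c)].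
transitivity #|family F|.
  apply: eq_card => f; rewrite inE.
  by apply/forallP/familyP => H x; have := H x; rewrite !inE.
rewrite card_family foldrE big_map big_enum /=.
rewrite (bigID (mem S)) /= [X in X * _]big1 ?mul1n; last first.
  move=> x xS; rewrite -(card1 c); apply: eq_card => b.
  by rewrite !inE xS.
rewrite (eq_bigr (fun=> 2)); last first.
  move=> x xS; rewrite -card_bool; apply: eq_card => b.
  by rewrite !inE (negbTE xS).
rewrite prod_nat_const; congr (2 ^ _).
by rewrite -(cardC (mem S)) addKn.
Qed.

(** Union bound: each n-set is monochromatic under at most [2 * 2 ^ (2 ^ N - 'C(n, k))] of the
    [2 ^ (2 ^ N)] colourings of all subsets. *)
Lemma counting_lower_bound k n N :
  2 * 'C(N, n) < 2 ^ 'C(n, k) -> ~~ ramsey_prop k n N.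
Proof.
rewrite ltnNge; apply: contra => /forallP H.
pose S (A : {set 'I_N}) := [set B : {set 'I_N} | B \subset A & #|B| == k].
pose G c A := [set f : {ffun {set 'I_N} -> bool} | [forall x in S A, f x == c]].
pose D := [set A : {set 'I_N} | #|A| == n].
have cD : #|D| = 'C(N, n) by rewrite card_draws card_ord.
have cG c A : A \in D -> #|G c A| = 2 ^ (2 ^ N - 'C(n, k)).
  rewrite inE => /eqP cA; rewrite card_constant_ffun cards_draws cA.
  by rewrite -cardsT -powersetT card_powerset cardsT card_ord.
have le1 : 2 ^ (2 ^ N) <= #|\bigcup_(A in D) (G true A :|: G false A)|.
  have -> : 2 ^ (2 ^ N) = #|[set: {ffun {set 'I_N} -> bool}]|.
    rewrite cardsT card_ffun card_bool -cardsT -powersetT card_powerset.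
    by rewrite cardsT card_ord.
  apply/subset_leq_card/subsetP => f _.
  have /existsP[A /andP[cA /existsP[c Hc]]] := H f.
  apply/bigcupP; exists A; first by rewrite inE.
  suff : f \in G c A by case: c {Hc} => fG; rewrite inE fG ?orbT.
  rewrite inE; apply/forall_inP => B; rewrite inE => BA.
  by move/forallP/(_ B): Hc; rewrite BA.
have le2 : #|\bigcup_(A in D) (G true A :|: G false A)|
    <= 'C(N, n) * (2 * 2 ^ (2 ^ N - 'C(n, k))).
  rewrite -cD -sum_nat_const.
  elim/big_rec2: _ => [|A s X AD le]; first by rewrite cards0.
  apply: leq_trans (leq_card_setU _ _) (leq_add _ le).
  rewrite mul2n -addnn -{1}(cG true A) // -(cG false A) //.
  exact: leq_card_setU.
(* An n-set must exist for ['C(n, k) <= 2 ^ N], which keeps the truncated subtraction exact. *)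
have [E|] := eqVneq D set0.
  by move: le1; rewrite E big_set0 cards0 leqNgt expn_gt0.
move=> /set0Pn[A]; rewrite inE => /eqP cA.
have Ck : 'C(n, k) <= 2 ^ N.
  rewrite -cA -cards_draws -[N in 2 ^ N]card_ord -cardsT -card_powerset powersetT.
  exact/subset_leq_card/subsetT.
have := leq_trans le1 le2.
rewrite -[in X in X <= _](subnK Ck) expnD mulnA [_ * 2]mulnC mulnC.
by rewrite leq_pmul2r // expn_gt0.
Qed.

(** * The highest differing binary digit *)

(* The position of the highest binary digit in which x and y < 2 ^ N differ;
   0 if x = y. *)
Definition delta N x y : nat := \max_(i < N | x %/ 2 ^ i != y %/ 2 ^ i) i.

Lemma leq_delta N x y i : i < N -> x %/ 2 ^ i != y %/ 2 ^ i -> i <= delta N x y.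
Proof.
move=> iN neq.
exact: (leq_bigmax_cond (F := fun i : 'I_N => i : nat) (Ordinal iN)).
Qed.

(** Division by [2 ^ i] is monotone, so the quotients of x and z differ exactly when those of x, y
    or those of y, z do. *)
Lemma delta_max N x y z :
  x <= y <= z -> delta N x z = maxn (delta N x y) (delta N y z).
Proof.
move=> /andP[xy yz]; apply/eqP; rewrite eqn_leq geq_max.
have le1 i := leq_div2r (2 ^ i) xy; have le2 i := leq_div2r (2 ^ i) yz.
apply/and3P; split; apply/bigmax_leqP => i neq.
- rewrite leq_max; have [E|neq'] := eqVneq (x %/ 2 ^ i) (y %/ 2 ^ i).
    by rewrite orbC leq_delta // -E.
  by rewrite leq_delta.
- by apply: leq_delta => //; have := le1 i; have := le2 i; lia.
- by apply: leq_delta => //; have := le1 i; have := le2 i; lia.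
Qed.

Lemma delta_spec N x y (d := delta N x y) : x < y -> y < 2 ^ N ->
  [/\ d < N, x %/ 2 ^ d < y %/ 2 ^ d & x %/ 2 ^ d.+1 = y %/ 2 ^ d.+1].
Proof.
move=> xy yN.
have N_gt0 : 0 < N by case: (N) yN => //; lia.
have [|i neq Ei] := @eq_bigmax_cond _ [pred i : 'I_N | x %/ 2 ^ i != y %/ 2 ^ i]
    (fun i : 'I_N => i : nat).
  apply/card_gt0P; exists (Ordinal N_gt0); rewrite inE /= expn0 !divn1; lia.
have {Ei}Ed : d = i by [].
rewrite Ed; split=> //.
  have := leq_div2r (2 ^ i) (ltnW xy); move: neq; rewrite inE /=; lia.
apply/eqP; case: eqVneq => // neq'.
have [iN | iN] := ltnP i.+1 N.
  suff : i < i by lia.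
  rewrite -{2}Ed.
  exact: leq_delta.
have eN : i.+1 = N by apply/eqP; rewrite eqn_leq ltn_ord.
by move: neq'; rewrite eN !divn_small ?eqxx //; lia.
Qed.

Lemma delta_lt N x y : x < y -> y < 2 ^ N -> delta N x y < N.
Proof. by move=> xy yN; have [] := @delta_spec N x y xy yN. Qed.

(** With a common value d, the quotients by [2 ^ d] would be three distinct numbers with the same
    half, but only two numbers share a half. *)
Lemma delta_neq N x y z :
  x < y -> y < z -> z < 2 ^ N -> delta N x y != delta N y z.
Proof.
move=> xy yz zN; apply/eqP => E.
have [_] := @delta_spec N x y xy (ltn_trans yz zN).
have [_] := @delta_spec N y z yz zN.
rewrite -E expnSr !divnMA; lia.
Qed.

(** * Difference sequences and their subsequences *)

Definition consec {S T : Type} (f : S -> S -> T) (s : seq S) : seq T :=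
  if s is x :: s' then pairmap f x s' else [::].

Lemma size_consec {S T} (f : S -> S -> T) s : size (consec f s) = (size s).-1.
Proof. by case: s => //= x s; rewrite size_pairmap. Qed.

Lemma nth_consec {S T} (f : S -> S -> T) x0 y0 s i :
  i.+1 < size s -> nth y0 (consec f s) i = f (nth x0 s i) (nth x0 s i.+1).
Proof. by case: s => //= x s i_s; rewrite (nth_pairmap x0). Qed.

Lemma drop_consec {S T} (f : S -> S -> T) i s :
  drop i (consec f s) = consec f (drop i s).
Proof.
case: s => // x s; elim: i x s => [|i IH] x [|y s] //=.
exact: IH.
Qed.

Lemma take_consec {S T} (f : S -> S -> T) i s :
  take i (consec f s) = consec f (take i.+1 s).
Proof.
case: s => //= x s; elim: s i x => [|y s IH] [|i] x //=.
by rewrite IH.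
Qed.

Lemma delta_mem_lt N b x s z : sorted leq (x :: s) ->
  all (gtn b) (consec (delta N) (x :: s)) -> z \in s -> delta N x z < b.
Proof.
elim: s x => // y s IH x xys /= /andP[dxy ds].
have /andP[xy ys] := xys.
rewrite inE => /predU1P[-> // | zs].
rewrite (@delta_max _ x y z) ?xy; first by rewrite gtn_max dxy IH.
by move/(order_path_min leq_trans)/allP: ys => /(_ z zs).
Qed.

(* A subsequence of decreasing differences is realized by the left end points of
   its terms, followed by the right end point of the last one. *)
Lemma subseq_decreasing N s e : sorted leq s -> s != [::] ->
  sorted gtn (consec (delta N) s) -> subseq e (consec (delta N) s) ->
  exists2 t, subseq t s & t != [::] /\ consec (delta N) t = e.
Proof.
case: s => // x s + _; elim: s x e => [|y s IH] x e.
  by move=> _ _ /eqP ->; exists [:: x]; rewrite ?subseq_refl.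
move=> xys dec; have /andP[xy ys] := xys.
have dec' := path_sorted dec.
case: e => [|a e] sub.
  by exists [:: x] => //; rewrite sub1seq mem_head.
move: sub; rewrite [consec _ _]/= [subseq _ _]/=; case: eqP => [-> sub|_ sub]; last first.
  have [t tys [t0 Et]] := IH y _ ys dec' sub.
  by exists t => //; apply: subseq_trans tys (subseq_cons _ _).
have [[|z t] tys [// _ Et]] := IH y _ ys dec' sub.
exists [:: x, z & t]; first by rewrite /= eqxx.
split=> //=; rewrite -[pairmap _ _ _]/(consec (delta N) (z :: t)) Et; congr cons.
have := mem_subseq tys (mem_head z t); rewrite inE => /predU1P[-> // | zs].
(* Skipping y is harmless: all differences between y and z are below [delta N x y]. *)
rewrite (@delta_max _ x y z) ?xy; last first.
  by move/(order_path_min leq_trans)/allP: ys => /(_ z zs).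
apply/maxn_idPl/ltnW; apply: (@delta_mem_lt N _ y s) => //.
by apply: (order_path_min _ dec) => a' b' c' /= ? ?; lia.
Qed.

(* Dually, increasing differences are realized by their right end points, so the
   first element x can always be kept. *)
Lemma subseq_increasing N x s e : sorted leq (x :: s) ->
  sorted ltn (consec (delta N) (x :: s)) ->
  subseq e (consec (delta N) (x :: s)) ->
  exists2 t, subseq t s & consec (delta N) (x :: t) = e.
Proof.
elim: s x e => [|y s IH] x e.
  by move=> _ _ /eqP ->; exists [::].
move=> xys inc; have /andP[xy ys] := xys.
have inc' := path_sorted inc.
case: e => [|a e] sub; first by exists [::]; rewrite ?sub0seq.
move: sub; rewrite [consec _ _]/= [subseq _ _]/=; case: eqP => [-> sub|_ sub].
  have [t tys Et] := IH y _ ys inc' sub.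
  by exists (y :: t); rewrite /= ?eqxx // -Et.
have [[|z t] tys // Et] := IH y _ ys inc' sub.
exists (z :: t); first by apply: subseq_trans tys (subseq_cons _ _).
rewrite -Et /=; congr cons.
have zs := mem_subseq tys (mem_head z t).
(* Here [delta N y z] is a later term, hence exceeds [delta N x y], and x can replace y. *)
rewrite (@delta_max _ x y z) ?xy; last first.
  by move/(order_path_min leq_trans)/allP: ys => /(_ z zs).
apply/maxn_idPr/ltnW.
have /= [-> _] := Et.
have := mem_subseq sub (mem_head a e).
by move/(order_path_min ltn_trans)/allP: inc; apply.
Qed.

(** * Long runs in Boolean sequences *)

(* Here u i records whether the i-th difference value is smaller than the next
   one, so that a change in u is a local extremum.  The hypothesis on u says that
   each window of w consecutive entries whose first change is at index p,
   after p entries equal to b, gets the same colour c. *)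
Definition forces_run (w M l : nat) : Prop :=
  forall (u : nat -> bool) (c : bool),
    (forall i b p, 0 < p < w -> i + w <= M ->
       (forall j, j < p -> u (i + j) = b) -> u (i + p) = ~~ b ->
       odd p (+) b = c) ->
    exists a b, a + l <= M /\ forall j, j < l -> u (a + j) = b.

(** A window of two entries can change only from [~~ c] to [c]. So u changes at most once, and the
    entry at l tells which half is constant. *)
Lemma forces_run2 l : forces_run 2 l.*2 l.
Proof.
move=> u c H.
have step i : i.+1 < l.*2 -> u i = c -> u i.+1 = c.
  move=> il ui; case E: (u i.+1 == c); first by move/eqP: E.
  have := H i c 1 isT; rewrite addn2 addn1 /= => /(_ il).
  move=> H'; suff: ~~ c = c by case: (c).
  apply: H'; first by case=> //; rewrite addn0.
  by move: E; case: (u i.+1); case: (c).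
case E: (u l == c); [exists l, c | exists 0, (~~ c)]; split; try lia.
  elim=> [|j IH] jl; first by rewrite addn0; apply/eqP.
  by rewrite addnS; apply: step; [lia | apply: IH; lia].
have back j : j <= l -> u (l - j) = ~~ c.
  elim: j => [|j IH] jl; first by rewrite subn0; move: E; case: (u l); case: (c).
  have := IH (ltnW jl); have := step (l - j.+1).
  rewrite -subSn // subSS; case: (u (l - j.+1)); case: (c) => //=.
    by move=> ->//; lia.
  by move=> ->//; lia.
by move=> j jl; rewrite -(back (l - j)); [congr u; lia | lia].
Qed.

Section Run.
Variables (w M : nat) (u : nat -> bool) (c : bool).
Hypotheses (w_ge3 : 3 <= w) (M_ge : 2 * w <= M.+2).
Hypothesis H : forall i b p, 0 < p < w -> i + w <= M ->
  (forall j, j < p -> u (i + j) = b) -> u (i + p) = ~~ b -> odd p (+) b = c.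

(** A change after i has position 1 in the window at i. The window at i - 1 first sees either this
    change at position 2 or one of the opposite type at position 1; both flip the colour. *)
Lemma no_change_away_from_start i : 0 < i -> i + w <= M -> u i.+1 = u i.
Proof.
case: i => // i _ iw; apply/eqP; case: eqP => // /eqP neq.
have H1 := @H i.+1 (u i.+1) 1; rewrite addn1 in H1.
have {}H1 : ~~ u i.+1 = c.
  apply: H1; [lia | lia | by case=> //; rewrite addn0 |].
  by move: neq; case: (u i.+1); case: (u i.+2).
case E: (u i == u i.+1).
  have H2 := @H i (u i.+1) 2; rewrite addn2 in H2.
  suff : u i.+1 = c by rewrite -H1; case: (u _).
  apply: H2; [lia | lia | | by move: neq; case: (u i.+1); case: (u i.+2)].
  by case=> [|[|]] // _; rewrite ?addn0 ?addn1 //; apply/eqP.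
have H2 := @H i (u i) 1; rewrite addn1 in H2.
suff : ~~ u i = c by rewrite -H1; move: E; case: (u i); case: (u i.+1).
apply: H2; [lia | lia | by case=> //; rewrite addn0 |].
by move: E; case: (u i); case: (u i.+1).
Qed.

Lemma constant_inside i : i.+2 < M -> u i.+1 = u 1.
Proof.
elim/ltn_ind: i => -[//|i] IH iM.
have [iw | iw] := leqP (i.+1 + w) M.
  by rewrite no_change_away_from_start ?IH //; lia.
apply/eqP; case: eqP => // /eqP neq.
have eq j : 0 < j -> j <= i.+1 -> u j = u 1.
  by case: j => // j _ ji; apply: IH; lia.
have neq' : u i.+2 = ~~ u 1 by move: neq; case: (u _); case: (u 1).
(* The first change near the end has positions [w.-1] and [w.-2] in two windows, of opposite parity.
   By [M_ge] both windows start at index 1 or later. *)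
have H1 := @H (i.+3 - w) (u 1) w.-1.
have H2 := @H (i.+4 - w) (u 1) (w.-2).
have {}H1 : odd w.-1 (+) u 1 = c.
  by apply: H1; [lia | lia | move=> j jw; apply: eq; lia | rewrite -neq'; congr u; lia].
have {}H2 : odd w.-2 (+) u 1 = c.
  by apply: H2; [lia | lia | move=> j jw; apply: eq; lia | rewrite -neq'; congr u; lia].
have Ew : w.-1 = w.-2.+1 by lia.
by move: H1; rewrite -H2 Ew /=; case: (odd _); case: (u 1).
Qed.

(** Changes at both ends would have opposite types but the odd positions 1 and [w.-1], hence
    different colours. *)
Lemma no_change_at_one_end : ~~ odd w -> u 0 = u 1 \/ u M.-1 = u 1.
Proof.
move=> ow; case E0: (u 0 == u 1); first by left; apply/eqP.
right; apply/eqP; case E1: (u M.-1 == u 1) => //.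
have H1 := @H 0 (~~ u 1) 1; have H2 := @H (M - w) (u 1) w.-1.
have {}H1 : true (+) ~~ u 1 = c.
  apply: H1; [lia | lia | case=> // _ | by rewrite negbK].
  by move: E0; rewrite addn0; case: (u 0); case: (u 1).
have {}H2 : odd w.-1 (+) u 1 = c.
  apply: H2; [lia | lia | move=> j jw | ].
    have -> : M - w + j = (M - w + j).-1.+1 by lia.
    by apply: constant_inside; lia.
  have -> : M - w + w.-1 = M.-1 by lia.
  by move: E1; case: (u _); case: (u 1).
have ow' : odd w.-1 by move: ow; case: (w) w_ge3 => //= w' _; rewrite negbK.
by move: H1; rewrite -H2 ow'; case: (u 1).
Qed.

End Run.

Lemma forces_run_sub2 w M : 3 <= w -> 2 * w <= M.+2 -> forces_run w M (M - 2).
Proof.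
move=> w3 Mw u c H; exists 1, (u 1); split; first by lia.
by move=> j jM; rewrite add1n; apply: (@constant_inside w M u c) => //; lia.
Qed.

Lemma forces_run_even w M :
  3 <= w -> ~~ odd w -> 2 * w <= M.+2 -> forces_run w M (M - 1).
Proof.
move=> w3 ow Mw u c H.
have mid i : i.+2 < M -> u i.+1 = u 1 by apply: (@constant_inside w M u c).
have [E|E] := @no_change_at_one_end w M u c w3 Mw H ow.
  exists 0, (u 1); split; first by lia.
  by case=> [|j] jM //; apply: mid; lia.
exists 1, (u 1); split; first by lia.
move=> j jM; rewrite add1n; have [jM'|jM'] := ltnP j.+2 M; first exact: mid.
by rewrite -E; congr u; lia.
Qed.

(** * The stepped-up colouring *)

Definition seq_set N (d : seq nat) : {set 'I_N} := [set i : 'I_N | val i \in d].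

(** The first entry of [u] that differs from its head marks the first local extremum, a maximum if
    the head is true. *)
Definition step_colour {N} (phi : {set 'I_N} -> bool) (s : seq nat) : bool :=
  let d := consec (delta N) s in
  let u := consec ltn d in
  if constant u then phi (seq_set N d) else odd (index (~~ head true u) u) (+) head true u.

Lemma step_colour_first_extremum N (phi : {set 'I_N} -> bool) s b p
    (u := consec ltn (consec (delta N) s)) :
  0 < p < size u -> (forall j, j < p -> nth true u j = b) ->
  nth true u p = ~~ b -> step_colour phi s = odd p (+) b.
Proof.
move=> /andP[p_gt0 pu] ub up; rewrite /step_colour -/u.
have hu : head true u = b by rewrite -nth0 ub.
have u_b : ~~ b \in u by rewrite -up mem_nth.
have ind : index (~~ b) u = p.
  apply/eqP; rewrite eqn_leq; apply/andP; split.
    by rewrite -{1}up leqNgt; apply/negP => /(before_find true)/=; rewrite up eqxx.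
  rewrite leqNgt; apply/negP => lt.
  by have := ub _ lt; rewrite nth_index //; case: (b).
rewrite hu ind ifF //; apply/negP => cu.
move: cu hu pu up; case: (u) => //= a u' /all_pred1P Eu' <-.
case: p p_gt0 {ub ind} => // p _; rewrite ltnS Eu' size_nseq /= => pu.
by rewrite nth_nseq pu; case: (a).
Qed.

Lemma consec_delta_lt N s : sorted ltn s -> all (gtn (2 ^ N)) s ->
  all (gtn N) (consec (delta N) s).
Proof.
case: s => // x s /=; elim: s x => //= y s IH x /andP[xy ys] /and3P[x2 y2 s2].
by rewrite delta_lt // IH //= y2.
Qed.

Lemma consec_delta_neq N s i : sorted ltn s -> all (gtn (2 ^ N)) s ->
  i.+2 < size s ->
  nth 0 (consec (delta N) s) i != nth 0 (consec (delta N) s) i.+1.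
Proof.
move=> ss s2 lti.
have lt j : j.+1 < size s -> nth 0 s j < nth 0 s j.+1.
  by move=> js; apply: (sorted_ltn_nth ltn_trans) => //; rewrite inE // ltnW.
rewrite !(nth_consec _ 0) //; last exact: ltnW.
apply: delta_neq; [exact/lt/ltnW | exact: lt |].
by have /allP/(_ (nth 0 s i.+2)) := s2; apply; apply: mem_nth.
Qed.

Lemma card_seq_set N d : uniq d -> all (gtn N) d -> #|seq_set N d| = size d.
Proof.
move=> ud dN.
have -> : seq_set N d = [set i in pmap insub d].
  by apply/setP => i; rewrite !inE mem_pmap_sub.
rewrite cardsE; move/card_uniqP: (pmap_sub_uniq 'I_N ud) => ->.
by rewrite size_pmap_sub; apply/eqP; rewrite -all_count.
Qed.

Lemma seq_set_subseq N (B : {set 'I_N}) d : uniq d -> all (gtn N) d ->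
  B \subset seq_set N d ->
  exists2 e, subseq e d & seq_set N e = B /\ size e = #|B|.
Proof.
move=> ud dN /subsetP BA; pose e := filter (mem (map val (enum B))) d.
have eB : seq_set N e = B.
  apply/setP => i; rewrite inE mem_filter /= mem_map ?mem_enum; last exact: val_inj.
  by case iB : (i \in B) => //=; have := BA i iB; rewrite inE.
exists e; first exact: filter_subseq.
split=> //; rewrite -(@card_seq_set N e) ?eB // ?filter_uniq //.
by rewrite all_filter; apply: sub_all dN => x xN; apply/implyP.
Qed.

Lemma all_consec_true (r : rel nat) s : all (pred1 true) (consec r s) = sorted r s.
Proof.
by case: s => // x s; elim: s x => //= y s IH x; rewrite IH eqb_id.
Qed.

Lemma all_consec_ltn_false s : all (pred1 false) (consec ltn s) = sorted geq s.
Proof.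
case: s => // x s; elim: s x => //= y s IH x.
by rewrite IH eqbF_neg -leqNgt.
Qed.

(** Each k-subset of monotone differences is itself the difference sequence of some k.+1 elements of
    s, whose colour is by definition its value under phi. *)
Lemma monochromatic_run N (phi : {set 'I_N} -> bool) k c b s :
  sorted ltn s -> all (gtn (2 ^ N)) s -> s != [::] -> 0 < k ->
  (forall t, subseq t s -> size t = k.+1 -> step_colour phi t = c) ->
  all (pred1 b) (consec ltn (consec (delta N) s)) ->
  uniq (consec (delta N) s) /\
  monochromatic k phi (seq_set N (consec (delta N) s)).
Proof.
move=> ss s2 s0 k0 H; set d := consec _ s => db.
have sl : sorted leq s by apply: sub_sorted ss => x y /ltnW.
have dN : all (gtn N) d by apply: consec_delta_lt.
suff [ud Hd] : uniq d /\ forall e, subseq e d -> size e = k ->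
    exists2 t, subseq t s & [/\ size t = k.+1, consec (delta N) t = e &
      all (pred1 b) (consec ltn e)].
  split=> //; apply/monochromaticP; exists c => B BA cB.
  have [e ed [eB se]] := seq_set_subseq ud dN BA.
  have [|t ts [st Et eb]] := Hd e ed; first by rewrite se cB.
  rewrite -eB -(H t ts st) /step_colour Et ifT //.
  by case: (consec ltn e) eb => //= a l /andP[/eqP ->].
have size_t t e : consec (delta N) t = e -> size e = k -> size t = k.+1.
  by move=> <-; rewrite size_consec; case: (t) => [|x t'] /=; lia.
case: b db => db.
  have dl : sorted ltn d by rewrite -all_consec_true.
  split=> [|e ed se]; first exact: (sorted_uniq ltn_trans ltnn).
  have [x [s' Es]] : exists x s', s = x :: s'.
    by case: (s) s0 => // x s' _; exists x, s'.
  move: sl ed (dl); rewrite /d Es => sl' ed dl'.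
  have [t ts Et] := subseq_increasing sl' dl' ed.
  exists (x :: t); rewrite /= ?eqxx //; split=> //; first exact: size_t Et se.
  by rewrite all_consec_true; apply: subseq_sorted ed dl'; apply: ltn_trans.
(* False comparisons give only weak decrease; strictness comes from neighbouring differences being
   distinct. *)
have dg : sorted gtn d.
  apply/(sortedP 0) => i; rewrite size_consec => lti.
  have := db; rewrite all_consec_ltn_false => /(sortedP 0) /(_ i).
  rewrite size_consec => /(_ lti) /= le.
  by have := @consec_delta_neq N s i ss s2; rewrite -/d; lia.
have gt_trans : transitive gtn by move=> y x z /= ? ?; lia.
split=> [|e ed se]; first by apply: (sorted_uniq gt_trans) dg => x /=; lia.
have [t ts [t0 Et]] := subseq_decreasing sl s0 dg ed.
exists t => //; split=> //; first exact: size_t Et se.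
rewrite all_consec_ltn_false; have := subseq_sorted gt_trans ed dg.
by apply: sub_sorted => x y /ltnW.
Qed.

Lemma size_window (T : Type) (s : seq T) i m : i + m <= size s -> size (take m (drop i s)) = m.
Proof. by move=> im; rewrite size_takel // size_drop; lia. Qed.

Lemma subseq_window (T : eqType) (s : seq T) i m : subseq (take m (drop i s)) s.
Proof. exact: subseq_trans (take_subseq _ _) (drop_subseq _ _). Qed.

Lemma consec2_window (s : seq nat) N i m :
  consec ltn (consec (delta N) (take m.+2 (drop i s))) =
  take m (drop i (consec ltn (consec (delta N) s))).
Proof. by rewrite -!take_consec -!drop_consec. Qed.

(** * Stepping up the uniformity *)

(** The shifts arise because [M.+2] elements have [M.+1] differences and M comparisons, and l equal
    comparisons span [l.+1] differences. *)
Lemma not_ramsey_prop_step w M l N : 0 < w -> forces_run w M l ->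
  ~~ ramsey_prop w.+1 l.+1 N -> ~~ ramsey_prop w.+2 M.+2 (2 ^ N).
Proof.
move=> w0 FR; apply: contra => /forallP HR; apply/forallP => phi.
have := HR [ffun B : {set 'I_(2 ^ N)} => step_colour phi (map val (enum B))].
move=> /existsP[A /andP[/eqP cA /monochromaticP[c Hc]]].
pose s := map val (enum A).
have ss : sorted ltn s.
  apply: (subseq_sorted ltn_trans) (iota_ltn_sorted 0 (2 ^ N)).
  rewrite -val_enum_ord; apply: map_subseq; rewrite [enum 'I__]enumT.
  exact: filter_subseq.
have s2 : all (gtn (2 ^ N)) s by apply/allP => x /mapP[i _ ->] /=.
have sz : size s = M.+2 by rewrite size_map -cardE.
have H t : subseq t s -> size t = w.+2 -> step_colour phi t = c.
  move=> ts st; have [m sm Et] := subseqP ts.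
  pose t' := mask m (enum A).
  have Et' : t = map val t' by rewrite Et map_mask.
  have ut' : uniq t' by rewrite mask_uniq ?enum_uniq.
  have t'A : subseq t' (enum A) := mask_subseq _ _.
  have Et'' : enum [set x in t'] = t'.
    rewrite [RHS](subseq_uniqP (enum_uniq _) t'A) -filter_predI.
    apply: eq_filter => x; rewrite /= !inE.
    by case xt : (x \in t') => //=; rewrite -mem_enum (mem_subseq t'A).
  have := Hc [set x in t']; rewrite ffunE Et'' -Et'; apply.
    by apply/subsetP => x; rewrite inE => /(mem_subseq t'A); rewrite mem_enum.
  by rewrite cardE Et'' -st Et' size_map.
pose u := consec ltn (consec (delta N) s).
have szu : size u = M by rewrite !size_consec sz.
have [i b p /andP[p0 pw] iw ub up|a [b [al ab]]] := FR (nth true u) c.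
  pose t := take w.+2 (drop i s).
  have Eu : consec ltn (consec (delta N) t) = take w (drop i u).
    exact: consec2_window.
  have st : size t = w.+2 by rewrite size_window // sz; lia.
  rewrite -(H t) //; last exact: subseq_window.
  apply/esym/step_colour_first_extremum; rewrite Eu ?size_window ?szu ?p0 //.
    by move=> j jp; rewrite nth_take ?nth_drop ?ub //; lia.
  by rewrite nth_take // nth_drop.
pose t := take l.+2 (drop a s).
have st : size t = l.+2 by rewrite size_window // sz; lia.
have ts : subseq t s := subseq_window _ _ _.
have [||||||ud mono] := @monochromatic_run N phi w.+1 c b t.
- exact: (subseq_sorted ltn_trans ts ss).
- by apply/allP => x /(mem_subseq ts); apply/allP.
- by rewrite -size_eq0 st.
- by [].
- by move=> t' t't; apply: H; apply: subseq_trans ts.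
- rewrite consec2_window; apply/(all_nthP true) => j.
  rewrite size_window ?szu // => jl.
  by rewrite nth_take // nth_drop ab /=.
apply/existsP; exists (seq_set N (consec (delta N) t)).
rewrite mono andbT card_seq_set ?size_consec ?st //.
apply: consec_delta_lt; first exact: (subseq_sorted ltn_trans ts ss).
by apply/allP => x /(mem_subseq ts); apply/allP.
Qed.

Lemma not_ramsey_prop_step3 n N : 0 < n ->
  ~~ ramsey_prop 3 n N -> ~~ ramsey_prop 4 n.*2 (2 ^ N).
Proof.
by case: n => // n _; apply: (not_ramsey_prop_step _ (@forces_run2 n)).
Qed.

Lemma not_ramsey_prop_step_add3 k n N : 4 <= k -> 0 < n -> 2 * k <= n + 5 ->
  ~~ ramsey_prop k n N -> ~~ ramsey_prop k.+1 (n + 3) (2 ^ N).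
Proof.
case: k => [//|w]; case: n => [//|l] w3 _ le.
rewrite addn3; apply: not_ramsey_prop_step; first by lia.
by have := @forces_run_sub2 w l.+2; rewrite subn2; apply; lia.
Qed.

Lemma not_ramsey_prop_step_add2 k n N :
  4 <= k -> odd k -> 0 < n -> 2 * k <= n + 4 ->
  ~~ ramsey_prop k n N -> ~~ ramsey_prop k.+1 (n + 2) (2 ^ N).
Proof.
case: k => [//|w]; case: n => [//|l] w3 /= ow _ le.
rewrite addn2; apply: not_ramsey_prop_step; first by lia.
by have := @forces_run_even w l.+1; rewrite subn1; apply; lia.
Qed.

(* The loss 2 * j + uphalf j alternates between 3 at even and 2 at odd
   uniformities. *)
Lemma not_ramsey_prop_iter j m N : 4 <= m -> ~~ ramsey_prop 4 m N ->
  ~~ ramsey_prop (4 + j) (m + 2 * j + uphalf j) (iter j (expn 2) N).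
Proof.
move=> m4 H; elim: j => [|j IH]; first by rewrite !addn0.
rewrite addnS iterS; case oj: (odd j).
  have -> : m + 2 * j.+1 + uphalf j.+1 = m + 2 * j + uphalf j + 2.
    by rewrite /= uphalf_half oj; lia.
  by apply: not_ramsey_prop_step_add2 IH => //; rewrite ?oddD ?oj; lia.
have -> : m + 2 * j.+1 + uphalf j.+1 = m + 2 * j + uphalf j + 3.
  by rewrite /= uphalf_half oj; lia.
by apply: not_ramsey_prop_step_add3 IH => //; lia.
Qed.

(** * Base cases at uniformities 2 and 3 *)

Lemma bin_le_expn N n : 'C(N, n) <= N ^ n.
Proof.
apply: (@leq_trans (N ^_ n)); first by rewrite -bin_ffact leq_pmulr ?fact_gt0.
elim: n N => // n IH N; rewrite ffactnS expnS leq_mul // (leq_trans (IH _)) //.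
by case: n {IH} => // n; rewrite leq_exp2r // leq_pred.
Qed.

Lemma counting_lower_bound_pow2 k n q :
  q * n + 1 < 'C(n, k) -> ~~ ramsey_prop k n (2 ^ q).
Proof.
move=> lt; apply: counting_lower_bound.
apply: (@leq_ltn_trans (2 ^ (q * n + 1))); last by rewrite ltn_exp2l.
by rewrite addn1 expnS leq_mul2l expnM bin_le_expn.
Qed.

Lemma not_ramsey_prop_3 m : 5 <= m -> ~~ ramsey_prop 3 m (2 ^ (m ^ 2 %/ 25)).
Proof.
move=> m5; apply: counting_lower_bound_pow2.
have q_le := leq_trunc_div (m ^ 2) 25; have := bin_ffact m 3.
move: q_le; set q := _ %/ _; set b := 'C(m, 3).
rewrite !ffactnS ffactn0 (_ : 3`! = 6) //.
rewrite -mulnn => q_le; move: q b q_le => q b.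
(* After the shift by 5, the expanded polynomials compare coefficient by coefficient. *)
case: m m5 => [|[|[|[|[|m]]]]] // _ /=; rewrite -(leq_pmul2r (ltn0Sn m.+4)) muln1.
have -> : m.+1.+4 * m.+1.+4 * m.+1.+4 = m * m * m + 15 * (m * m) + 75 * m + 125 by lia.
have -> : m.+1.+4 * (m.+4 * m.+3) = m * m * m + 12 * (m * m) + 47 * m + 60 by lia.
by rewrite [q * 25]mulnC -mulnA; lia.
Qed.

(** The exponent is at most (n - 2) / 2, so its product with n is below ['C(n, 2)] by at least n /
    2. *)
Lemma not_ramsey_prop_2 n : 6 <= n -> ~~ ramsey_prop 2 n (2 ^ n./2.-1).
Proof.
move=> n6; apply: counting_lower_bound_pow2.
have bin_n := mul_bin_left n 1; rewrite bin1 in bin_n.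
have : n./2.-1 * 2 * n <= (n - 2) * n by rewrite leq_mul2r; lia.
by case: n n6 bin_n => [|[|n]] //; move: (_./2.-1) => q n4; nia.
Qed.

Lemma sqr_le_expn2 q : (q.*2 + 3) ^ 2 <= 13 * 2 ^ q.
Proof.
do 3![case: q => // q].
elim: q => // q IH; rewrite [2 ^ _]expnS; nia.
Qed.

(** * Assembling the tower bound and its constant *)

Lemma ramsey_lower_bound k n : 2 <= k -> 3 * k <= n ->
  exists2 q, n ^ 2 <= 3600 * q &
    ~~ ramsey_prop k n (iter (k - 2) (expn 2) q).
Proof.
case: k => [|[|[|[|j]]]] // _ nk.
- exists (2 ^ n./2.-1); last by apply: not_ramsey_prop_2; lia.
  have le : n ^ 2 <= (n./2.-1.*2 + 3) ^ 2 by rewrite leq_sqr; lia.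
  apply: leq_trans le (leq_trans (sqr_le_expn2 _) _).
  by rewrite leq_mul2r orbC.
- exists (n ^ 2 %/ 25); last by apply: not_ramsey_prop_3; lia.
  have : 25 <= n ^ 2 by rewrite (@leq_sqr 5); lia.
  by move: (n ^ 2) => a; lia.
pose m := (n - 2 * j - uphalf j)./2.
(* As j <= n / 3 - 4, the loss is at most 5n / 6 - 19 / 2; halving what is left gives m >= n / 12 +
   4. *)
have nm : n <= 12 * (m - 4) by rewrite /m uphalf_half; lia.
have m5 : 5 <= m by rewrite /m uphalf_half; lia.
exists (m ^ 2 %/ 25).
  (* The constant is 3600 = 12 ^ 2 * 25; the spare 24 absorbs the remainder of the division by
     25. *)
  have : n ^ 2 <= (12 * (m - 4)) ^ 2 by rewrite leq_sqr.
  have : (m - 4) ^ 2 + 24 <= m ^ 2 by rewrite -!mulnn; nia.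
  by rewrite expnMn; move: (m ^ 2) (n ^ 2) ((m - 4) ^ 2) => a b d; lia.
have H : ~~ ramsey_prop 4 m.*2 (2 ^ (2 ^ (m ^ 2 %/ 25))).
  by apply: not_ramsey_prop_step3 (not_ramsey_prop_3 m5); lia.
have {}H := not_ramsey_prop_iter j _ H.
(* One exponential from counting and one from the step to uniformity 4 complete the j iterations to
   k - 2. *)
rewrite subSS subSS subn0 !iterSr; apply: contra (H _); last by lia.
by rewrite add4n; apply: ramsey_prop_leq_size; rewrite /m; lia.
Qed.

Local Open Scope ring_scope.

Lemma iter_powR_le (R : realType) j (x : R) q : x <= q%:R ->
  iter j (fun y : R => 2 `^ y) x <= (iter j (expn 2) q)%:R.
Proof.
move=> xq; elim: j => //= j IH.
by rewrite natrX -powR_mulrn // ler_powR // ler1n.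
Qed.

Theorem mainTheorem4 (R : realType) :
  exists c : R, 0 < c /\
    forall k n : nat, (2 <= k)%N -> (3 * k <= n)%N ->
      tower k.-1 (c * n%:R ^+ 2) <= (ramsey_number k n)%:R.
Proof.
exists 3600%:R^-1; split; first by rewrite invr_gt0 ltr0n.
move=> k n k2 nk; have [q nq Hq] := ramsey_lower_bound k2 nk.
apply: (@le_trans _ _ (iter (k - 2) (expn 2) q)%:R); last first.
  by rewrite ler_nat ltnW // ramsey_number_gt.
rewrite /tower; have -> : (k.-1.-1 = k - 2)%N by lia.
apply: iter_powR_le.
by rewrite ler_pdivrMl ?ltr0n // -natrX -natrM ler_nat.
Qed.
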